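(* Let $K_1,\ldots,K_t$ and $L_1,\ldots,L_t$ be reversible (i.e., $L^2(\pi)$-self-adjoint) kernels all belonging to $\mathcal{F}$, and suppose that $K_s \preceq L_s$ for $s=1,\ldots,t$. Then the product kernels $K_1\cdots K_t$ and $L_1\cdots L_t$ and their time-reversals all belong to $\mathcal{F}$, and $K_1\cdots K_t \preceq L_1\cdots L_t$.
   Context: $\mathcal{X}$ is a given finite partially ordered set and $\pi$ is a given probability mass function on $\mathcal{X}$ with $\pi(i)>0$ for all $i$. For $f,g:\mathcal{X}\to\mathbf{R}$ put $\langle f,g\rangle=\sum_{i\in\mathcal{X}}\pi(i)f(i)g(i)$. A kernel $K$ acts on functions by $(Kf)(i)=\sum_j K(i,j)f(j)$. $\mathcal{K}$ is the set of Markov kernels (row-stochastic matrices) on $\mathcal{X}$ having $\pi$ as stationary distribution ($\pi K=\pi$). $\mathcal{M}$ is the set of nonnegative nonincreasing functions on $\mathcal{X}$ (that is, $x\le y$ implies $f(x)\ge f(y)$). $\mathcal{F}$ is the set of $K\in\mathcal{K}$ that are stochastically monotone, meaning $Kf\in\mathcal{M}$ for every $f\in\mathcal{M}$. The time-reversal of $K\in\mathcal{K}$ is its $L^2(\pi)$-adjoint $K^*(i,j)=\pi(j)K(j,i)/\pi(i)$; $K$ is reversible if $K=K^*$. For $K,L\in\mathcal{K}$ write $K\preceq L$ (a comparison inequality) if $\langle Kf,g\rangle\le\langle Lf,g\rangle$ for all $f,g\in\mathcal{M}$. *)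

(* Defs.v *)
From HB Require Import structures.
From mathcomp Require Import all_boot all_order all_algebra reals.

Set Implicit Arguments.
Unset Strict Implicit.
Unset Printing Implicit Defensive.

Import Order.TTheory GRing.Theory Num.Theory.
Local Open Scope ring_scope.

Section Kernels.
Context {d : Order.disp_t} {X : finPOrderType d} {R : realType}.
Implicit Types (pi f g : X -> R) (K L : X -> X -> R).

Definition positive_pmf pi : Prop :=
  (forall i, 0 < pi i) /\ \sum_i pi i = 1.

Definition inner pi f g : R := \sum_i pi i * f i * g i.

Definition kact K f : X -> R := fun i => \sum_j K i j * f j.

Definition kmul K L : X -> X -> R := fun i k => \sum_j K i j * L j k.

Definition kid : X -> X -> R := fun i j => (i == j)%:R.

(* K_1 K_2 ... K_t in this order, with K_s stored at index s - 1; the empty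
   product (t = 0) is the identity kernel. *)
Definition kprod (t : nat) (K : 'I_t -> X -> X -> R) : X -> X -> R :=
  \big[kmul/kid]_(s < t) K s.

Definition markov_kernel K : Prop :=
  (forall i j, 0 <= K i j) /\ (forall i, \sum_j K i j = 1).

Definition stationary pi K : Prop := forall j, \sum_i pi i * K i j = pi j.

Definition stationary_kernel pi K : Prop :=
  markov_kernel K /\ stationary pi K.

(* The order on X is Order.le (%O); the
   one on R is that of ring_scope. *)
Definition nonneg_nonincr f : Prop :=
  (forall x, 0 <= f x) /\ (forall x y, (x <= y)%O -> f y <= f x).

Definition stoch_monotone K : Prop :=
  forall f, nonneg_nonincr f -> nonneg_nonincr (kact K f).

Definition monotone_kernel pi K : Prop :=
  stationary_kernel pi K /\ stoch_monotone K.

Definition time_reversal pi K : X -> X -> R :=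
  fun i j => pi j * K j i / pi i.

(* K = K^*, stated entrywise because kernels are plain functions. *)
Definition reversible pi K : Prop := forall i j, K i j = time_reversal pi K i j.

Definition comparison_le pi K L : Prop :=
  forall f g, nonneg_nonincr f -> nonneg_nonincr g ->
    inner pi (kact K f) g <= inner pi (kact L f) g.

End Kernels.

(* Main.v *)
Require Import Defs.
From HB Require Import structures.
From mathcomp Require Import all_boot all_order all_algebra reals.
From mathcomp Require Import ring.

(** The kernels that are stochastically monotone together with their
    time-reversal form a monoid under composition: composition preserves
    stationarity and monotonicity, and reversal is an anti-morphism,
    [(KL)^* = L^* K^*].  Reversible monotone kernels belong to this monoid, hence
    so do their products ([bimonotone_kprod]); the products themselves need not
    be reversible, which is why the invariant carried along the product is
    two-sided monotonicity.

    Comparison inequalities are compatible with the composition of this monoid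
    ([comparison_kmul]): if [K <= L] and [M <= N], then for nonnegative
    nonincreasing [f] and [g]
    [<KMf, g> <= <LMf, g> = <Mf, L^*g> <= <Nf, L^*g> = <LNf, g>],
    the first inequality because [Mf] is again a legitimate test function, the
    second because [L^*g] is.  The comparison of the two products follows by
    induction on the number of factors. *)

Import Order.TTheory GRing.Theory Num.Theory.
Local Open Scope ring_scope.

Section KernelComposition.
Context {d : Order.disp_t} {X : finPOrderType d} {R : realType}.
Implicit Types (pi f g : X -> R) (K L M N : X -> X -> R).

Lemma kact_kmul K L f i : kact (kmul K L) f i = kact K (kact L f) i.
Proof.
rewrite /kact /kmul; under eq_bigr do rewrite mulr_suml.
rewrite exchange_big; apply: eq_bigr => k _ /=.
by rewrite mulr_sumr; apply: eq_bigr => j _; rewrite mulrA.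
Qed.

Lemma kact_kid f i : kact kid f i = f i.
Proof.
rewrite /kact /kid (bigD1 i) //= eqxx mul1r big1 ?addr0 // => j ji.
by rewrite eq_sym (negbTE ji) mul0r.
Qed.

Lemma eq_inner pi f f' g g' :
  f =1 f' -> g =1 g' -> inner pi f g = inner pi f' g'.
Proof. by move=> ff' gg'; apply: eq_bigr => i _; rewrite ff' gg'. Qed.

Lemma eq_nonneg_nonincr f f' :
  f =1 f' -> nonneg_nonincr f -> nonneg_nonincr f'.
Proof.
by move=> ff' [f0 fle]; split=> [x|x y xy]; rewrite -!ff' //; apply: fle.
Qed.

Lemma eq_monotone_kernel pi K K' :
  K =2 K' -> monotone_kernel pi K -> monotone_kernel pi K'.
Proof.
move=> KK' [[[K0 K1] Kpi] Kmon]; split; first split; first split.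
- by move=> i j; rewrite -KK'.
- by move=> i; rewrite -(K1 i); apply: eq_bigr => j _; rewrite KK'.
- by move=> j; rewrite -(Kpi j); apply: eq_bigr => i _; rewrite KK'.
- move=> f /Kmon; apply: eq_nonneg_nonincr => i.
  by apply: eq_bigr => j _; rewrite KK'.
Qed.

Lemma monotone_kernel_kid pi : monotone_kernel pi (@kid d X R).
Proof.
split; first split; first split.
- by move=> i j; apply: ler0n.
- move=> i; rewrite -[RHS](kact_kid (fun=> 1) i).
  by apply: eq_bigr => j _; rewrite mulr1.
- move=> j; rewrite -[RHS](kact_kid pi j).
  by apply: eq_bigr => i _; rewrite /kid mulrC eq_sym.
- by move=> f; apply: eq_nonneg_nonincr => i; rewrite kact_kid.
Qed.

Lemma monotone_kernel_kmul pi K L :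
  monotone_kernel pi K -> monotone_kernel pi L ->
  monotone_kernel pi (kmul K L).
Proof.
move=> [[[K0 K1] Kpi] Kmon] [[[L0 L1] Lpi] Lmon].
split; first split; first split.
- by move=> i j; apply: sumr_ge0 => k _; apply: mulr_ge0.
- move=> i; rewrite /kmul exchange_big -[RHS](K1 i).
  by apply: eq_bigr => k _; rewrite -mulr_sumr L1 mulr1.
- move=> j; rewrite /kmul -[RHS](Lpi j).
  under eq_bigr do rewrite mulr_sumr.
  rewrite exchange_big; apply: eq_bigr => k _ /=.
  by rewrite -(Kpi k) mulr_suml; apply: eq_bigr => i _; rewrite mulrA.
- move=> f /Lmon /Kmon; apply: eq_nonneg_nonincr => i.
  by rewrite kact_kmul.
Qed.

Section PositiveWeight.
Variable pi : X -> R.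
Hypothesis pi_gt0 : forall i, 0 < pi i.

Let pi_neq0 i : pi i != 0. Proof. by rewrite gt_eqF. Qed.

Lemma time_reversal_kid : kid =2 time_reversal pi kid.
Proof.
move=> i j; rewrite /time_reversal /kid eq_sym.
by case: eqP => [->|_]; rewrite ?mulr1 ?mulfV // mulr0 mul0r.
Qed.

Lemma time_reversal_kmul K L :
  kmul (time_reversal pi L) (time_reversal pi K)
    =2 time_reversal pi (kmul K L).
Proof.
move=> i j; rewrite /time_reversal /kmul mulr_sumr mulr_suml.
by apply: eq_bigr => k _; field; rewrite !pi_neq0.
Qed.

Lemma inner_kact_adjoint K f g :
  inner pi (kact K f) g = inner pi f (kact (time_reversal pi K) g).
Proof.
rewrite /inner /kact /time_reversal.
under eq_bigr do rewrite mulr_sumr mulr_suml.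
under [RHS]eq_bigr do rewrite mulr_sumr.
rewrite exchange_big; apply: eq_bigr => j _; apply: eq_bigr => i _ /=.
by field.
Qed.

Definition bimonotone K :=
  monotone_kernel pi K /\ monotone_kernel pi (time_reversal pi K).

Lemma bimonotone_reversible K :
  reversible pi K -> monotone_kernel pi K -> bimonotone K.
Proof. by move=> Krev Kmon; split=> //; apply: eq_monotone_kernel Kmon. Qed.

Lemma bimonotone_kid : bimonotone kid.
Proof.
apply: bimonotone_reversible (monotone_kernel_kid pi).
exact: time_reversal_kid.
Qed.

Lemma bimonotone_kmul K L : bimonotone K -> bimonotone L -> bimonotone (kmul K L).
Proof.
move=> [Kmon Krmon] [Lmon Lrmon]; split; first exact: monotone_kernel_kmul.
apply: eq_monotone_kernel (time_reversal_kmul K L) _.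
exact: monotone_kernel_kmul.
Qed.

Lemma bimonotone_kprod t (K : 'I_t -> X -> X -> R) :
  (forall s, bimonotone (K s)) -> bimonotone (kprod K).
Proof.
move=> Kbi; apply: big_ind => // [|A B]; first exact: bimonotone_kid.
exact: bimonotone_kmul.
Qed.

(** The factors are replaced one at a time, passing through [LM]: replacing [K]
    tests the first inequality on [Mf] and [g]; to replace [M], [L] is first
    moved to the other side of the inner product, and the second inequality is
    tested on [f] and [L^*g]. *)
Lemma comparison_kmul K L M N :
  stoch_monotone M -> stoch_monotone (time_reversal pi L) ->
  comparison_le pi K L -> comparison_le pi M N ->
  comparison_le pi (kmul K M) (kmul L N).
Proof.
move=> Mmon Lrmon KL MN f g fM gM.
rewrite !(eq_inner _ _ _ _ _ (kact_kmul _ _ f) (frefl g)).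
apply: (le_trans (KL _ _ (Mmon _ fM) gM)).
by rewrite !(inner_kact_adjoint L); apply: MN => //; apply: Lrmon.
Qed.

Lemma comparison_kprod t (K L : 'I_t -> X -> X -> R) :
  (forall s, bimonotone (K s)) -> (forall s, bimonotone (L s)) ->
  (forall s, comparison_le pi (K s) (L s)) ->
  comparison_le pi (kprod K) (kprod L).
Proof.
move=> Kbi Lbi KL.
(* The comparison alone is not inductive: composing on the left with a further
   pair of factors requires the partial product of the [K s] to be monotone. *)
suff [] : bimonotone (kprod K) /\ comparison_le pi (kprod K) (kprod L) by [].
rewrite /kprod; elim/big_rec2: _ => [|s N M _ [Mbi MN]].
  by split=> [|f g _ _]; [exact: bimonotone_kid | exact: lexx].
split; first exact: bimonotone_kmul.
by apply: comparison_kmul => //; [case: Mbi => -[] | case: (Lbi s) => _ []].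
Qed.

End PositiveWeight.
End KernelComposition.

Theorem proposition2p4 (R : realType) (d : Order.disp_t) (X : finPOrderType d)
    (pi : X -> R) (t : nat) (K L : 'I_t -> X -> X -> R)
    (hpi : positive_pmf pi)
    (hKrev : forall s, reversible pi (K s))
    (hLrev : forall s, reversible pi (L s))
    (hKF : forall s, monotone_kernel pi (K s))
    (hLF : forall s, monotone_kernel pi (L s))
    (hKL : forall s, comparison_le pi (K s) (L s)) :
  [/\ monotone_kernel pi (kprod K),
      monotone_kernel pi (kprod L),
      monotone_kernel pi (time_reversal pi (kprod K)),
      monotone_kernel pi (time_reversal pi (kprod L))
    & comparison_le pi (kprod K) (kprod L)].
Proof.
have [pi_gt0 _] := hpi.
have Kbi s : bimonotone pi (K s) by apply: bimonotone_reversible.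
have Lbi s : bimonotone pi (L s) by apply: bimonotone_reversible.
have [? ?] := bimonotone_kprod _ pi_gt0 _ _ Kbi.
have [? ?] := bimonotone_kprod _ pi_gt0 _ _ Lbi.
by split=> //; apply: comparison_kprod.
Qed.
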